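(* There is an absolute constant $C>0$ such that for all integers $n\ge 2$ and $w\ge 2$ the following holds. Let $f:\{0,1\}^n\to\{0,1\}$ be computed by a width-$w$, length-$n$, read-once, oblivious branching program. Then $$L^1(f)=\sum_{i\in[n]}|\widehat f[\{i\}]|\le C\cdot (C\log_2 n)^{w-2}.$$
   Context: For $f:\{0,1\}^n\to\mathbb{R}$ and $s\subseteq[n]$, $\widehat f[s]=\mathbb{E}_U[f(U)(-1)^{\sum_{i\in s}U_i}]$ with $U$ uniform on $\{0,1\}^n$. A length-$n$, width-$w$ ordered branching program has layers of vertices $V_0,\dots,V_n$ with $|V_i|\le w$ and transition maps $T_i:V_{i-1}\times\{0,1\}\to V_i$; on input $x$ it starts at a fixed $u_0\in V_0$ and follows $T_i(\cdot,x_i)$; it computes $f$ if for some $S\subseteq V_n$, $f(x)=1$ iff the final vertex lies in $S$. A read-once, oblivious branching program computes $x\mapsto f'(\pi(x))$ where $f'$ is computed by an ordered branching program and $\pi$ permutes the coordinates. *)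

(* Defs.v *)
From HB Require Import structures.
From mathcomp Require Import all_boot all_order all_fingroup all_algebra.
From mathcomp Require Import reals exp.

Set Implicit Arguments.
Unset Strict Implicit.
Unset Printing Implicit Defensive.

Import Order.TTheory GRing.Theory Num.Theory.

Definition cube (n : nat) := {ffun 'I_n -> bool}.

(* The layers are indexed by all of [nat] so that layer [i.+1] needs no cast;
   only the layers [i <= n] and the transitions out of the layers [i < n] are
   constrained or used. Coordinates are numbered from 0: [step] at [i] goes
   from layer [i] to layer [i.+1] and reads coordinate [i]. *)
Record ordered_bp (n w : nat) := OrderedBP {
  layer : nat -> finType;
  width_layer : forall i : nat, i <= n -> #|layer i| <= w;
  step : forall i : nat, i < n -> layer i -> bool -> layer i.+1;
  start : layer 0
}.

Fixpoint run (n w : nat) (B : ordered_bp n w) (x : cube n) (i : nat) :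
    i <= n -> layer B i :=
  match i return i <= n -> layer B i with
  | 0 => fun _ => start B
  | j.+1 => fun ltjn : j < n =>
      step ltjn (run B x (ltnW ltjn)) (x (Ordinal ltjn))
  end.

Definition final (n w : nat) (B : ordered_bp n w) (x : cube n) : layer B n :=
  run B x (leqnn n).

Definition computed_by_ordered_bp (n w : nat) (f : cube n -> bool) : Prop :=
  exists (B : ordered_bp n w) (S : {set layer B n}),
    forall x : cube n, f x = (final B x \in S).

Definition permute_coords (n : nat) (p : {perm 'I_n}) (x : cube n) : cube n :=
  [ffun i => x (p i)].

Definition computed_by_read_once_oblivious_bp
    (n w : nat) (f : cube n -> bool) : Prop :=
  exists (f' : cube n -> bool) (p : {perm 'I_n}),
    computed_by_ordered_bp w f' /\
    forall x : cube n, f x = f' (permute_coords p x).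

Local Open Scope ring_scope.

Definition unif_expectation (R : realType) (n : nat) (g : cube n -> R) : R :=
  (\sum_(x : cube n) g x) / #|{: cube n}|%:R.

Definition fourier (R : realType) (n : nat) (f : cube n -> R)
    (s : {set 'I_n}) : R :=
  unif_expectation (fun x => f x * (-1) ^+ (\sum_(i in s) x i)%N).

Definition L1 (R : realType) (n : nat) (f : cube n -> R) : R :=
  \sum_(i < n) `|fourier f [set i]|.

Definition log2 (R : realType) (x : R) : R := ln x / ln 2.

(* Main.v *)
Require Import Defs.
From HB Require Import structures.
From mathcomp Require Import all_boot all_order all_fingroup all_algebra.
From mathcomp Require Import reals exp.
From mathcomp Require Import lra ring.

Set Implicit Arguments.
Unset Strict Implicit.
Unset Printing Implicit Defensive.

Import Order.TTheory GRing.Theory Num.Theory.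
Local Open Scope ring_scope.

(** Let [q v] be the acceptance probability from the state [v]. Along a uniformly
    random input [q] is a martingale, and [sum_i |f^[i]|] is at most the expected
    sum of the absolute values of its increments. This expectation is bounded
    through potentials [F] with [F v >= |increment at v| + (mean of F over the
    successors)], built by induction on the number [k] of states per layer that
    the walk may visit before it is stopped.
      Given a nonnegative function [x], harmonic up to a nonnegative drift that
    depends only on the layer, the increment at [v] is at most [x v] plus the
    drift, so only the [O(log n)] scales [eta] between the maximum of [x] and
    [1/n] of it matter. At each scale the expected number of visits to the band
    [(eta/2, 2 eta)] is [O(max x / eta)], and one visit costs [O(eta)] times the
    bound for the walk confined to the band. If [x] vanishes somewhere in each
    layer, the band has one state fewer, and a factor [O(log n)] is paid per
    state. For a program of width [w], taking both [q - min q] and [max q - q]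
    (each on the half where it is the smaller one) removes two states at once,
    which gives the exponent [w - 2].
      A stopped walk may leave to arbitrary values, so [x] need not be extremal at
    a visited state; adding a multiple of the (recentred) probability of leaving
    makes leaving the maximal outcome and restores this. *)

(** * Potentials for stopped walks on a layered graph *)

Section Potentials.

Context (R : realFieldType) (V : finType) (tm : V -> nat) (ch : V -> bool -> V).
Context (n : nat).
(* All layers are pooled in [V]: [tm] gives the index of the layer, and [ch] is
   meaningful only below layer [n]. *)
Hypothesis tm_ch : forall v b, (tm v < n)%N -> tm (ch v b) = (tm v).+1.

Implicit Types (Q : {set V}) (x c F : V -> R) (d : nat -> R) (W B : R).

Definition avg F v := (F (ch v false) + F (ch v true)) / 2.

Definition osc F v := `|F (ch v false) - F (ch v true)| / 2.

Definition dominates Q F c :=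
  (forall v, 0 <= F v) /\
  (forall v, v \in Q -> (tm v < n)%N -> c v + avg F v <= F v).

Definition bounded W x := forall v, 0 <= x v <= W.

Definition drifts Q d x :=
  forall v, v \in Q -> (tm v < n)%N -> avg x v = x v + d (tm v).

Definition width_le Q k :=
  forall t, (t < n)%N -> (#|[set u in Q | tm u == t]| <= k)%N.

(* The drift may have either sign here; outside [Q] the walk is stopped. *)
Definition width_bound k B :=
  forall Q x d W, 0 <= W -> bounded W x -> drifts Q d x -> width_le Q k ->
  exists2 F, dominates Q F (osc x) & forall v, F v <= B * W.

Lemma osc_ge0 F v : 0 <= osc F v.
Proof. by rewrite /osc divr_ge0. Qed.

Lemma osc_le_avg x v : (forall u, 0 <= x u) -> osc x v <= avg x v.
Proof.
move=> x0; rewrite /osc /avg ler_pM2r ?invr_gt0//.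
by have := x0 (ch v false); have := x0 (ch v true); rewrite ler_norml; lra.
Qed.

Lemma avg_le F G v : (forall b, F (ch v b) <= G (ch v b)) -> avg F v <= avg G v.
Proof. by move=> FG; rewrite /avg ler_pM2r ?invr_gt0// lerD. Qed.

Lemma dominatesD Q F1 F2 c1 c2 c :
  dominates Q F1 c1 -> dominates Q F2 c2 ->
  (forall v, v \in Q -> (tm v < n)%N -> c v <= c1 v + c2 v) ->
  dominates Q (fun v => F1 v + F2 v) c.
Proof.
move=> [F10 F1P] [F20 F2P] cP; split=> [v|v vQ tv]; first exact: addr_ge0.
have := F1P v vQ tv; have := F2P v vQ tv; have := cP v vQ tv.
by rewrite /avg; lra.
Qed.

(* During a visit to the band the cost is paid by [S]. Up to the drift, which is
   paid by [6 mu (W - x)], the concave function [off = 6 mu (min x eta)] and the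
   affine function [on = 2 mu (eta + x)] are supermartingales. They cross exactly
   at the ends of the band, and [off - on >= mu eta >= S] on the core
   [eta < x <= 3/2 eta], so [min off (S + on)] pays for every visit. *)
Lemma dominates_one_scale Q x d W eta mu (act : nat -> bool) S :
  0 < eta -> 0 <= mu -> bounded W x -> drifts Q d x ->
  (forall v, v \in Q -> (tm v < n)%N -> 0 <= d (tm v)) ->
  (forall t, (t < n)%N -> act t -> act t.+1) ->
  let band := [set v in Q |
    [&& act (tm v), d (tm v) <= eta, eta / 2 < x v & x v < 2 * eta]] in
  dominates band S (osc x) -> (forall v, S v <= mu * eta) ->
  exists2 F,
    dominates Q F (fun v => if [&& act (tm v), d (tm v) <= eta, eta < x v
                               & x v <= 3 / 2 * eta] then osc x v else 0)
    & forall v, F v <= 6 * mu * eta + 6 * mu * W.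
Proof.
move=> eta0 mu0 xW xd d0 actS band [S0 SP] Smu.
pose S' v := if v \in band then S v else 0.
pose off v := 6 * Num.min (mu * x v) (mu * eta).
pose on v := 2 * (mu * eta + mu * x v).
pose H v := if act (tm v) then Num.min (off v) (S' v + on v) else off v.
have S'0 v : 0 <= S' v by rewrite /S'; case: ifP.
have mx0 v : 0 <= mu * x v <= mu * W.
  by have /andP[a b] := xW v; rewrite mulr_ge0// ler_wpM2l.
have me0 : 0 <= mu * eta by rewrite mulr_ge0// ltW.
have off0 v : 0 <= off v.
  by have /andP[a b] := mx0 v; rewrite /off mulr_ge0// le_min a me0.
have on0 v : 0 <= on v.
  by have /andP[a b] := mx0 v; rewrite /on mulr_ge0// addr_ge0.
have H0 v : 0 <= H v.
  rewrite /H; case: ifP => // _; rewrite le_min off0/=.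
  by rewrite addr_ge0.
have Hoff v : H v <= off v by rewrite /H; case: ifP => // _; rewrite ge_min lexx.
have offE v : off v <= 6 * (mu * eta) /\ off v <= 6 * (mu * x v).
  by split; rewrite /off ler_wpM2l// ge_min lexx ?orbT.
exists (fun v => H v + 6 * (mu * W - mu * x v)); last first.
  move=> v; have := Hoff v; have [] := offE v; have /andP[] := mx0 v.
  rewrite -!mulrA; lra.
split=> [v|v vQ tv].
  by have /andP[] := mx0 v; have := H0 v; lra.
have dv := d0 v vQ tv.
have mdv : 0 <= mu * d (tm v) by rewrite mulr_ge0.
have mxd : mu * x (ch v false) + mu * x (ch v true)
         = 2 * (mu * x v) + 2 * (mu * d (tm v)).
  have E : x (ch v false) + x (ch v true) = 2 * (x v + d (tm v)).
    by have := xd v vQ tv; rewrite /avg; lra.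
  by rewrite -mulrDr E; ring.
have avgoff : avg off v <= off v + 6 * (mu * d (tm v)).
  have [a b] := offE (ch v false); have [a' b'] := offE (ch v true).
  rewrite /avg [off v]/off.
  by case: (leP (mu * x v) (mu * eta)) => _; lra.
have avgon : avg on v = on v + 2 * (mu * d (tm v)) by rewrite /avg /on; lra.
have avgH : avg H v <= avg off v by exact: avg_le.
suff key : (if [&& act (tm v), d (tm v) <= eta, eta < x v & x v <= 3 / 2 * eta]
            then osc x v else 0) + avg H v <= H v + 6 * (mu * d (tm v)).
  move: key; rewrite /avg; set c := if _ then _ else _; lra.
have [actv|] := boolP (act (tm v)); last first.
  by move=> nact; rewrite /H (negPf nact)/= -/(avg _ _); lra.
(* A drift above [eta] pays by itself: [avg off v <= 6 * (mu * eta) <= 6 * (mu * d (tm v))]. *)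
have [dsmall|dbig] := leP (d (tm v)) eta; last first.
  rewrite /= add0r.
  have : avg off v <= 6 * (mu * eta).
    by have [a b] := offE (ch v false); have [a' b'] := offE (ch v true);
      rewrite /avg; lra.
  have : mu * eta <= mu * d (tm v) by rewrite ler_wpM2l// ltW.
  by have := H0 v; lra.
have [vband|vband] := boolP (v \in band); last first.
  have := vband; rewrite inE vQ actv dsmall/= negb_and -!leNgt => xout.
  have -> : (eta < x v) && (x v <= 3 / 2 * eta) = false.
    by apply/negP => /andP[a b]; case/orP: xout; lra.
  rewrite add0r; suff -> : H v = off v by lra.
  rewrite /H actv /S' (negPf vband) add0r; apply/min_idPl.
  have [a b] := offE v; rewrite /on.
  case/orP: xout => xo.
    by have : 2 * (mu * x v) <= mu * eta; [rewrite mulrCA ler_wpM2l//; lra|lra].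
  by have : 2 * (mu * eta) <= mu * x v; [rewrite mulrCA ler_wpM2l//; lra|lra].
have SH : osc x v + avg H v <= S' v + on v + 6 * (mu * d (tm v)).
  have := SP v vband tv; rewrite [S' v]/S' vband.
  suff : avg H v <= avg S v + avg on v by lra.
  rewrite -mulrDl addrACA -/(avg (fun u => S u + on u) v).
  (* [actS] keeps the successors active, so [H] is a minimum there and lies below [S + on]. *)
  apply: avg_le => b; rewrite /H tm_ch// actS// ge_min /S'.
  by apply/orP; right; case: ifP => // _; rewrite lerD2r.
have -> : H v = Num.min (off v) (S' v + on v) by rewrite /H actv.
have c0 := osc_ge0 x v.
rewrite /=; case: ifP => [/andP[xl xu]|_].
  have -> : Num.min (off v) (S' v + on v) = S' v + on v.
    apply/min_idPr; rewrite /off.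
    have -> : Num.min (mu * x v) (mu * eta) = mu * eta.
      by apply/min_idPr; rewrite ler_wpM2l// ltW.
    rewrite /S' vband /on; have := Smu v.
    have : 2 * (mu * x v) <= 3 * (mu * eta).
      by rewrite mulrCA [leRHS]mulrCA ler_wpM2l//; lra.
    lra.
  exact: SH.
rewrite add0r -lerBlDr le_min !lerBlDr; apply/andP; split; lra.
Qed.

(** * Summation over geometric scales *)

(** Passing from [J] to [J.+1] adds the scale [eta = W * (2 / 3) ^+ J.+1]. If the drift [d] exceeds
    [eta] and [x <= 3 / 2 * eta], then [osc x <= x + d < 5 / 2 * d], hence the deduction in the
    cost. *)
Lemma dominates_scales Q x d W (D : nat -> R) B k J :
  0 < W -> 0 <= B -> width_bound k B -> bounded W x -> drifts Q d x ->
  (forall v, v \in Q -> (tm v < n)%N -> 0 <= d (tm v)) ->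
  (forall t, (t < n)%N -> D t <= D t.+1) ->
  (forall eta, 0 < eta -> width_le
     [set v in Q | [&& 2 * eta <= D (tm v), eta / 2 < x v & x v < 2 * eta]] k) ->
  exists2 F,
    dominates Q F (fun v => if (W * (2 / 3) ^+ J < x v) && (2 * x v <= D (tm v))
                            then osc x v - 5 / 2 * d (tm v) else 0)
    & forall v, F v <= J%:R * (72 * B * W).
Proof.
move=> W0 B0 wB xW xd d0 Dmon Dw; elim: J => [|J [F FP FB]].
  exists (fun=> 0) => [|v]; last by rewrite mul0r.
  split=> // v vQ tv; rewrite expr0 mulr1 ltNge.
  by have /andP[_ ->] := xW v; rewrite /= /avg; lra.
set r : R := (2 / 3) ^+ J in FP *.
have r0 : 0 < r by rewrite exprn_gt0//; lra.
have r1 : r <= 1 by rewrite exprn_ile1//; lra.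
pose eta : R := W * r * (2 / 3).
have eta0 : 0 < eta by rewrite !mulr_gt0//; lra.
have etaE : W * r = 3 / 2 * eta by rewrite /eta; field.
have etaW : eta <= W.
  have : W * r <= W * 1 by rewrite ler_wpM2l// ltW.
  by rewrite /eta; lra.
pose act t := 2 * eta <= D t.
have actS t : (t < n)%N -> act t -> act t.+1.
  by move=> tn; rewrite /act => /le_trans; apply; exact: Dmon.
pose band := [set v in Q |
    [&& act (tm v), d (tm v) <= eta, eta / 2 < x v & x v < 2 * eta]].
(* From the band, the mean of [x] over the successors is below [3 * eta]; as [x] is nonnegative,
   neither successor exceeds [6 * eta], so the truncation is invisible to the stopped walk. *)
pose x' v := Num.min (x v) (6 * eta).
have xch v b : v \in band -> (tm v < n)%N -> x (ch v b) <= 6 * eta.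
  rewrite inE => /and5P[vQ _ dv _ xv] tv.
  have := xd v vQ tv; rewrite /avg.
  have /andP[a _] := xW (ch v false); have /andP[a' _] := xW (ch v true).
  by case: b; lra.
have x'ch v b : v \in band -> (tm v < n)%N -> x' (ch v b) = x (ch v b).
  by move=> vb tv; apply/min_idPl; exact: xch.
have [||||S SP SB] := wB band x' d (6 * eta).
- by lra.
- move=> v; have /andP[a b] := xW v.
  by rewrite /x' le_min ge_min lexx orbT a andbT/=; lra.
- move=> v vb tv; rewrite /avg !x'ch// -/(avg x v).
  have := vb; rewrite inE => /and5P[vQ _ _ _ xv].
  rewrite (xd v vQ tv) /x'; congr (_ + _); apply/esym/min_idPl; lra.
- move=> t tn; apply: leq_trans (Dw eta eta0 t tn); apply: subset_leq_card.
  apply/subsetP=> v; rewrite !inE => /andP[/and5P[-> a _ -> ->] ->].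
  by rewrite -/(act _) a.
have [|||G GP GB] := @dominates_one_scale Q x d W eta (6 * B) act S
  eta0 _ xW xd d0 actS.
  by rewrite mulr_ge0.
- split=> [|v vb tv]; first by case: SP.
  by have := SP.2 v vb tv; rewrite /osc !x'ch.
- by move=> v; have := SB v; rewrite mulrCA mulrA.
exists (fun v => F v + G v); last first.
  move=> v; rewrite -natr1 mulrDl mul1r lerD//; apply: le_trans (GB v) _.
  have : B * eta <= B * W by rewrite ler_wpM2l.
  by rewrite -!mulrA; lra.
apply: dominatesD FP GP _ => v vQ tv.
have c0 := osc_ge0 x v; have dv := d0 v vQ tv.
have cd : osc x v <= x v + d (tm v).
  by rewrite -(xd v vQ tv) osc_le_avg// => u; case/andP: (xW u).
rewrite exprSr -/r [W * (r * _)]mulrA -/eta.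
have [xl|xl] := ltP eta (x v); last first.
  have -> : W * r < x v = false by apply/negbTE; rewrite -leNgt; lra.
  by rewrite /= !andbF addr0.
case: (leP (2 * x v) (D (tm v))) => xD /=; last first.
  by rewrite andbF add0r; case: ifP.
rewrite andbT /act (_ : 2 * eta <= D (tm v)) /=; last lra.
case: (ltP (W * r) (x v)) => xr /=.
  by rewrite (_ : x v <= 3 / 2 * eta = false) ?andbF/= ?addr0//;
    apply/negbTE; rewrite -ltNge; lra.
rewrite (_ : x v <= 3 / 2 * eta) ?andbT; last lra.
by case: (leP (d (tm v)) eta) => dd; lra.
Qed.

Lemma dominates_multiscale Q x d W (D : nat -> R) B k J :
  (0 < n)%N -> (n%:R : R) * (2 / 3) ^+ J <= 1 ->
  0 < W -> 0 <= B -> width_bound k B -> bounded W x -> drifts Q d x ->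
  (forall v, v \in Q -> (tm v < n)%N -> 0 <= d (tm v)) ->
  (forall t, (t < n)%N -> D t <= D t.+1) ->
  (forall eta, 0 < eta -> width_le
     [set v in Q | [&& 2 * eta <= D (tm v), eta / 2 < x v & x v < 2 * eta]] k) ->
  exists2 F,
    dominates Q F (fun v => if 2 * x v <= D (tm v) then osc x v else 0)
    & forall v, F v <= (72 * J%:R * B + 7 / 2) * W.
Proof.
move=> n0 nJ W0 B0 wB xW xd d0 Dmon Dw.
have [F FP FB] := dominates_scales J W0 B0 wB xW xd d0 Dmon Dw.
set om := W * (2 / 3) ^+ J in FP.
have om0 : 0 <= om by rewrite mulr_ge0 ?exprn_ge0 ?divr_ge0// ltW.
(* The first term pays [om <= W / n] per remaining step, for states with [x v <= om]; the second
   pays [5 / 2] times the drift. *)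
pose G v := (n - tm v)%:R * om + 5 / 2 * (W - x v).
have G0 v : 0 <= G v.
  have /andP[_ xle] := xW v; rewrite /G addr_ge0//; last by lra.
  by apply: mulr_ge0.
have GP : dominates Q G (fun v => om + 5 / 2 * d (tm v)).
  split=> // v vQ tv; have := xd v vQ tv; rewrite /avg /G !tm_ch//.
  have -> : (n - tm v)%:R * om = (n - (tm v).+1)%:R * om + om.
    by rewrite -[X in _ = _ + X]mul1r -mulrDl natr1 subnSK.
  lra.
exists (fun v => F v + G v); last first.
  move=> v; have := FB v; have /andP[? _] := xW v.
  have : (n - tm v)%:R * om <= W.
    apply: (@le_trans _ _ (n%:R * om)).
      by rewrite ler_wpM2r// ler_nat leq_subr.
    by rewrite /om mulrCA -[leRHS]mulr1 ler_wpM2l// ltW.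
  rewrite /G mulrDl [72 * _ * _]mulrAC [_ * B * J%:R]mulrC -!mulrA; lra.
apply: dominatesD FP GP _ => v vQ tv.
have c0 := osc_ge0 x v; have dv := d0 v vQ tv.
have cd : osc x v <= x v + d (tm v).
  by rewrite -(xd v vQ tv) osc_le_avg// => u; case/andP: (xW u).
case: (2 * x v <= D (tm v)); last by rewrite andbF; lra.
by rewrite andbT; case: ltP => xo; lra.
Qed.

(** * Layer minima and the exit potential *)

(** The default [W] also caps the minimum and is the value of an empty layer. *)
Definition layer_min Q W F t : R := \big[Num.min/W]_(u in Q | tm u == t) F u.

Lemma layer_min_le Q W F u : u \in Q -> layer_min Q W F (tm u) <= F u.
Proof. by move=> uQ; apply: bigmin_le_cond; rewrite uQ eqxx. Qed.

Lemma layer_min_le_default Q W F t : layer_min Q W F t <= W.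
Proof. exact: bigmin_le_id. Qed.

Lemma layer_min_ge0 Q W F t : 0 <= W -> (forall u, 0 <= F u) -> 0 <= layer_min Q W F t.
Proof. by move=> W0 F0; apply: le_bigmin. Qed.

Lemma layer_min_attained Q W F u : u \in Q -> F u <= W ->
  exists2 a, a \in Q & tm a = tm u /\ F a = layer_min Q W F (tm u).
Proof.
move=> uQ uW; have Pu : (u \in Q) && (tm u == tm u) by rewrite uQ eqxx.
have [a /andP[aQ /eqP ta] amin] :=
  @arg_minP _ R V u (fun v => (v \in Q) && (tm v == tm u)) F Pu.
exists a => //; split=> //; apply/le_anti/andP; split.
  by apply: le_bigmin => //; exact: le_trans (amin u Pu) uW.
by rewrite -ta; exact: layer_min_le.
Qed.

(** Every layer that meets [Q'] loses the witness [a]; in use, [a] is extremal in its layer. *)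
Lemma width_le_subset_remove Q Q' k :
  Q' \subset Q ->
  (forall u, u \in Q' -> exists a, [/\ a \in Q, tm a = tm u & a \notin Q']) ->
  width_le Q k.+1 -> width_le Q' k.
Proof.
move=> /subsetP sQ hQ wQ t tn.
have [->|[u]] := set_0Vmem [set u in Q' | tm u == t]; first by rewrite cards0.
rewrite inE => /andP[uQ /eqP tu]; have [a [aQ ta aQ']] := hQ u uQ.
have := wQ t tn; rewrite (cardsD1 a) inE aQ ta tu eqxx add1n ltnS.
apply: leq_trans; apply: subset_leq_card; apply/subsetP=> v.
rewrite !inE => /andP[vQ ->]; rewrite (sQ v vQ) !andbT.
by apply: contraNneq aQ' => <-.
Qed.

(** Here [m] stands for the number of steps left. It is common to a layer, so recentring costs only
    a drift that depends on the layer. *)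
Fixpoint exit_rec Q W (m : nat) (v : V) : R :=
  if v \in Q then
    if m is m'.+1 then
      avg (exit_rec Q W m') v - layer_min Q W (avg (exit_rec Q W m')) (tm v)
    else 0
  else W.

Lemma avg_bounded W F : bounded W F -> bounded W (avg F).
Proof.
move=> FW v; have /andP[a b] := FW (ch v false); have /andP[a' b'] := FW (ch v true).
by rewrite /avg; lra.
Qed.

Lemma exit_rec_bounded Q W m : 0 <= W -> bounded W (exit_rec Q W m).
Proof.
move=> W0; elim: m => [|m IH] v /=; case: ifP => vQ; rewrite ?lexx ?W0//.
have /andP[a b] := avg_bounded IH v.
have := layer_min_le W (avg (exit_rec Q W m)) vQ.
have := @layer_min_ge0 Q W (avg (exit_rec Q W m)) (tm v) W0.
move=> /(_ (fun u => proj1 (andP (avg_bounded IH u)))); lra.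
Qed.

(* The probability of leaving [Q], times [W], recentred at every layer so that
   it vanishes somewhere in each layer of [Q] but still equals [W] outside. *)
Lemma exit_potential Q W : 0 <= W ->
  exists z d,
    [/\ bounded W z, forall v, v \notin Q -> z v = W, drifts Q d z,
        forall t, 0 <= d t
      & forall u, u \in Q -> exists a, [/\ a \in Q, tm a = tm u & z a = 0]].
Proof.
move=> W0; pose z v := exit_rec Q W (n - tm v) v.
pose d t := layer_min Q W (avg (exit_rec Q W (n - t.+1))) t.
have bd m : bounded W (exit_rec Q W m) by exact: exit_rec_bounded.
have zE v : v \in Q -> (tm v < n)%N ->
    z v = avg (exit_rec Q W (n - (tm v).+1)) v - d (tm v).
  by move=> vQ tv; rewrite /z -(subnSK tv) /= vQ.
exists z, d; split.
- by move=> v; exact: bd.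
- by move=> v vQ; rewrite /z; case: (n - tm v)%N => [|m] /=; rewrite (negPf vQ).
- by move=> v vQ tv; rewrite zE// subrK /avg /z !tm_ch.
- move=> t; apply: layer_min_ge0 => // u.
  by have /andP[] := avg_bounded (bd (n - t.+1)%N) u.
move=> u uQ; have [tu|tu] := ltnP (tm u) n; last first.
  by exists u; rewrite /z (eqP (_ : n - tm u == 0)%N) /= ?uQ// subn_eq0.
have [|a aQ [ta aE]] :=
    @layer_min_attained Q W (avg (exit_rec Q W (n - (tm u).+1))) u uQ.
  by have /andP[] := avg_bounded (bd (n - (tm u).+1)%N) u.
by exists a; split=> //; rewrite zE// ?ta// aE subrr.
Qed.

(** * Induction on the number of states per layer *)

Lemma width_bound0 : width_bound 0 0.
Proof.
move=> Q x d W W0 xW xd wQ; exists (fun=> 0) => [|v]; last by rewrite mul0r.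
split=> // v vQ tv; have := wQ _ tv; rewrite leqn0 cards_eq0 => /eqP/setP/(_ v).
by rewrite !inE vQ eqxx.
Qed.

(* The oscillation of [x] is bounded by those of [y = x + z - m] and of the exit
   potential [z]. Each of them is nonnegative with nonnegative drift and vanishes
   somewhere in each layer, because leaving [Q] is never below the layer minimum. *)
Lemma width_boundS k B J :
  (0 < n)%N -> (n%:R : R) * (2 / 3) ^+ J <= 1 -> 0 <= B ->
  width_bound k B -> width_bound k.+1 (3 * (72 * J%:R * B + 7 / 2)).
Proof.
move=> n0 nJ B0 wB Q x d W; rewrite le_eqVlt => /orP[/eqP<-|W0] xW xd wQ.
  exists (fun=> 0) => [|v]; last by rewrite mulr0.
  have x0 v : x v = 0 by apply/le_anti; rewrite andbC.
  by split=> // v _ _; rewrite /osc /avg !x0 subrr normr0; lra.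
have [z [dz [zW zout zd dz0 zzero]]] := exit_potential Q (ltW W0).
pose xz v := x v + z v.
pose m := layer_min Q W xz.
have m0 t : 0 <= m t.
  apply: layer_min_ge0 => [|u]; first exact: ltW.
  by have /andP[a _] := xW u; have /andP[a' _] := zW u; rewrite addr_ge0.
pose y v := xz v - m (tm v).
have yzero u : u \in Q -> exists a, [/\ a \in Q, tm a = tm u & y a = 0].
  (* At a zero of [z], [xz b = x b <= W], so the cap [W] does not undercut the true layer
     minimum. *)
  move=> /zzero[b [bQ tb zb]].
  have [|a aQ [ta aE]] := @layer_min_attained Q W xz b bQ.
    by rewrite /xz zb addr0; have /andP[] := xW b.
  by exists a; split=> //; [rewrite ta|rewrite /y aE ta subrr].
have yW : bounded (2 * W) y.
  move=> v; have /andP[a b] := xW v; have /andP[a' b'] := zW v.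
  have mv := m0 (tm v); rewrite /y /xz.
  have [vQ|vQ] := boolP (v \in Q).
    by have := layer_min_le W xz vQ; rewrite -/m /xz; lra.
  by have := layer_min_le_default Q W xz (tm v); rewrite -/m zout//; lra.
pose dy t := d t + dz t + m t - m t.+1.
have yd : drifts Q dy y.
  move=> v vQ tv; have := xd v vQ tv; have := zd v vQ tv.
  by rewrite /avg /y /xz /dy !tm_ch//; lra.
(* At a zero of [y] in the layer, the drift equals the mean of [y] over the successors. *)
have dy0 v : v \in Q -> (tm v < n)%N -> 0 <= dy (tm v).
  move=> vQ tv; have [a [aQ ta ya]] := yzero v vQ.
  have := yd a aQ; rewrite ta ya add0r => /(_ tv) <-.
  rewrite /avg; have /andP[? _] := yW (ch a false); have /andP[? _] := yW (ch a true).
  lra.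
have band_width (f : V -> R) (c : R) :
    (forall u, u \in Q -> exists a, [/\ a \in Q, tm a = tm u & f a = 0]) ->
    forall eta : R, 0 < eta ->
    width_le [set v in Q | [&& 2 * eta <= c, eta / 2 < f v & f v < 2 * eta]] k.
  move=> fzero eta eta0; apply: width_le_subset_remove wQ.
    by apply/subsetP=> v; rewrite inE => /andP[].
  move=> u; rewrite inE => /andP[/fzero[a [aQ ta fa]] _].
  exists a; split=> //; rewrite inE fa negb_and; apply/orP; right.
  by apply/negP => /and3P[_ ? _]; lra.
(* The thresholds [4 * W] and [2 * W] make the cutoff vacuous, since [y <= 2 * W] and [z <= W];
   these two bounds add up to the factor 3. *)
have [||F1 F1P F1B] := @dominates_multiscale Q y dy (2 * W) (fun=> 4 * W) B k J
  n0 nJ _ B0 wB yW yd dy0 _ (band_width y _ yzero) => //.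
  by rewrite mulr_gt0.
have [|F2 F2P F2B] := @dominates_multiscale Q z dz W (fun=> 2 * W) B k J
  n0 nJ W0 B0 wB zW zd (fun v _ _ => dz0 (tm v)) _ (band_width z _ zzero) => //.
exists (fun v => F1 v + F2 v); last first.
  by move=> v; have := F1B v; have := F2B v; lra.
apply: dominatesD F1P F2P _ => v vQ tv.
have -> : 2 * y v <= 4 * W by have /andP[] := yW v; lra.
have -> : 2 * z v <= 2 * W by have /andP[] := zW v; lra.
rewrite /osc -mulrDl ler_pM2r ?invr_gt0//.
have -> : x (ch v false) - x (ch v true) =
   (y (ch v false) - y (ch v true)) - (z (ch v false) - z (ch v true)).
  by rewrite /y /xz !tm_ch//; ring.
exact: ler_normB.
Qed.

(** * The unstopped walk: removing two states at once *)

Lemma dominates_lower_half q q' B k J :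
  (0 < n)%N -> (n%:R : R) * (2 / 3) ^+ J <= 1 -> 0 <= B -> width_bound k B ->
  (forall v, 0 <= q v) -> (forall v, 0 <= q' v) -> (forall v, q v + q' v = 1) ->
  (forall v, (tm v < n)%N -> avg q v = q v) -> width_le [set: V] k.+2 ->
  exists2 F,
    dominates [set: V] F (fun v =>
      if 2 * (q v - layer_min setT 1 q (tm v))
         <= 1 - layer_min setT 1 q (tm v) - layer_min setT 1 q' (tm v)
      then osc q v else 0)
    & forall v, F v <= 72 * J%:R * B + 7 / 2.
Proof.
move=> n0 nJ B0 wB q0 q0' qq' qh wV.
have q1 v : q v <= 1 by have := q0' v; have := qq' v; lra.
have q1' v : q' v <= 1 by have := q0 v; have := qq' v; lra.
have qh' v : (tm v < n)%N -> avg q' v = q' v.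
  move=> /qh; have := qq' v; have := qq' (ch v false); have := qq' (ch v true).
  by rewrite /avg; lra.
pose m := layer_min setT 1 q; pose m' := layer_min setT 1 q'.
have mle v : m (tm v) <= q v by apply: layer_min_le; rewrite inE.
have mle' v : m' (tm v) <= q' v by apply: layer_min_le; rewrite inE.
have matt u : exists a, tm a = tm u /\ q a = m (tm u).
  by have [|a _ ?] := @layer_min_attained setT 1 q u (in_setT u); [|exists a].
have matt' u : exists a, tm a = tm u /\ q' a = m' (tm u).
  by have [|a _ ?] := @layer_min_attained setT 1 q' u (in_setT u); [|exists a].
have mmon u : (tm u < n)%N -> m (tm u).+1 <= m (tm u).
  move=> tu; have [a [ta <-]] := matt u; rewrite -ta in tu *.
  rewrite -qh// /avg -(tm_ch false tu).
  by have := mle (ch a false); have := mle (ch a true); rewrite !tm_ch//; lra.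
have mmon' u : (tm u < n)%N -> m' (tm u).+1 <= m' (tm u).
  move=> tu; have [a [ta <-]] := matt' u; rewrite -ta in tu *.
  rewrite -qh'// /avg -(tm_ch false tu).
  by have := mle' (ch a false); have := mle' (ch a true); rewrite !tm_ch//; lra.
have m0 t : 0 <= m t by apply: layer_min_ge0.
have m0' t : 0 <= m' t by apply: layer_min_ge0.
have m1 t : m t <= 1 by exact: layer_min_le_default.
have m1' t : m' t <= 1 by exact: layer_min_le_default.
(* On a nonempty layer this is the spread of [q], its maximum minus its minimum. *)
pose D t := 1 - m t - m' t.
pose x v := q v - m (tm v).
pose d t := m t - m t.+1.
have xW : bounded 1 x.
  by move=> v; have := mle v; have := q1 v; have := m0 (tm v); rewrite /x; lra.
have xd : drifts setT d x.
  by move=> v _ tv; have := qh v tv; rewrite /avg /x /d !tm_ch//; lra.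
have [|||F FP FB] := @dominates_multiscale setT x d 1 D B k J n0 nJ ltr01 B0 wB xW xd.
- by move=> v _ /mmon; rewrite /d; lra.
- move=> t tn; rewrite /D.
  (* In an empty layer both minima take the default 1, so [D t = -1], the least possible value. *)
  have [t0|[u]] := set_0Vmem [set u | tm u == t]; last first.
    rewrite inE => /eqP tu; rewrite -tu in tn *.
    by have := mmon u tn; have := mmon' u tn; lra.
  have E F : layer_min setT 1 F t = 1.
    rewrite /layer_min big_pred0// => u; rewrite inE/=.
    by have /setP/(_ u) := t0; rewrite !inE.
  by rewrite {1}/m {1}/m' !E; have := m1 t.+1; have := m1' t.+1; lra.
- move=> eta eta0.
  (* [Q1] drops the minimum of [q], where [x] is 0; the band then drops its maximum, where [x]
     equals [D], at least [2 * eta]. *)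
  pose Q1 := [set v | (2 * eta <= D (tm v)) && (0 < x v)].
  have wQ1 : width_le Q1 k.+1.
    apply: width_le_subset_remove wV; first exact: subsetT.
    move=> u _; have [a [ta qa]] := matt u; exists a; split=> //.
    by rewrite !inE /x qa ta subrr ltxx andbF.
  apply: width_le_subset_remove wQ1.
    apply/subsetP=> v; rewrite !inE /= => /and3P[-> ? _].
    by rewrite /=; lra.
  move=> u; rewrite !inE /= => /and3P[uD xu xu'].
  have [a [ta qa]] := matt' u; have xa : x a = D (tm u).
    by have := qq' a; rewrite /x /D ta qa; lra.
  exists a; split=> //; rewrite !inE /= ta uD xa; first lra.
  by apply/negP => /and3P[_ _ ?]; lra.
exists F => [|v]; last by rewrite (le_trans (FB v))// mulr1.
split=> [v|v vT tv]; first by case: FP.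
have := FP.2 v vT tv; rewrite /osc /x !tm_ch//.
have -> : q (ch v false) - m (tm v).+1 - (q (ch v true) - m (tm v).+1)
        = q (ch v false) - q (ch v true) by ring.
by [].
Qed.

Lemma dominates_width q B k J :
  (0 < n)%N -> (n%:R : R) * (2 / 3) ^+ J <= 1 -> 0 <= B -> width_bound k B ->
  bounded 1 q -> (forall v, (tm v < n)%N -> avg q v = q v) ->
  width_le [set: V] k.+2 ->
  exists2 F, dominates [set: V] F (osc q)
    & forall v, F v <= 2 * (72 * J%:R * B + 7 / 2).
Proof.
move=> n0 nJ B0 wB qW qh wV; pose q' v := 1 - q v.
have q0 v : 0 <= q v by have /andP[] := qW v.
have q0' v : 0 <= q' v by have /andP[] := qW v; rewrite /q'; lra.
have qq' v : q v + q' v = 1 by rewrite /q'; lra.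
have qh' v : (tm v < n)%N -> avg q' v = q' v.
  by move=> /qh; rewrite /avg /q'; lra.
have [F FP FB] := dominates_lower_half n0 nJ B0 wB q0 q0' qq' qh wV.
have [|G GP GB] := dominates_lower_half n0 nJ B0 wB q0' q0 _ qh' wV.
  by move=> v; rewrite addrC.
exists (fun v => F v + G v); last by move=> v; have := FB v; have := GB v; lra.
apply: dominatesD FP GP _ => v _ _; have c0 := osc_ge0 q v.
have -> : osc q' v = osc q v.
  rewrite /osc distrC /q'; congr (`|_| / 2); ring.
(* The heights of [q v] and [q' v] above their layer minima add up to the common threshold, so one
   of them is at most half of it. *)
case: (leP (2 * (q v - _)) _) => h; first by case: ifP => _; lra.
by rewrite ifT; [lra|have := qq' v; lra].
Qed.

(** * Solving the recursion for the constants *)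

(** As [J <= 4 * l], one step multiplies [B] by at most [864 * l] and adds [21 / 2]; carrying
    [l * B + 1] absorbs the summand into the factor [1728 * l]. *)
Lemma width_bound_log k J (l : R) :
  (0 < n)%N -> (n%:R : R) * (2 / 3) ^+ J <= 1 -> 1 <= l -> J%:R <= 4 * l ->
  exists B, [/\ 0 <= B, width_bound k B & l * B + 1 <= (1728 * l) ^+ k].
Proof.
move=> n0 nJ l1 Jl; elim: k => [|k [B [B0 wB IH]]].
  by exists 0; split; [|exact: width_bound0|rewrite mulr0 add0r expr0].
exists (3 * (72 * J%:R * B + 7 / 2)); split.
- have : 0 <= J%:R * B by rewrite mulr_ge0.
  by rewrite -mulrA; lra.
- exact: width_boundS.
have l0 : 0 < l by lra.
have JB : J%:R * B <= 4 * (l * B) by rewrite mulrA ler_wpM2r.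
rewrite exprS; apply: (@le_trans _ _ (1728 * l * (l * B + 1))); last first.
  by rewrite ler_wpM2l// mulr_ge0// ltW.
have : l * (J%:R * B) <= l * (4 * (l * B)) by rewrite ler_wpM2l// ltW.
have : 0 <= l * (l * B) by rewrite !mulr_ge0// ltW.
set X := l * (l * B); have -> : l * (4 * (l * B)) = 4 * X by rewrite /X; ring.
have -> : l * (3 * (72 * J%:R * B + 7 / 2))
        = 216 * (l * (J%:R * B)) + 21 / 2 * l by field.
have -> : 1728 * l * (l * B + 1) = 1728 * X + 1728 * l by rewrite /X; ring.
lra.
Qed.

Lemma osc_potential k J q (l : R) :
  (0 < n)%N -> (n%:R : R) * (2 / 3) ^+ J <= 1 -> 1 <= l -> J%:R <= 4 * l ->
  bounded 1 q -> (forall v, (tm v < n)%N -> avg q v = q v) ->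
  width_le [set: V] k.+2 ->
  exists2 F, dominates [set: V] F (osc q)
    & forall v, F v <= 1728 * (1728 * l) ^+ k.
Proof.
move=> n0 nJ l1 Jl qW qh wV.
have [B [B0 wB Bl]] := width_bound_log k n0 nJ l1 Jl.
have [F FP FB] := dominates_width n0 nJ B0 wB qW qh wV.
exists F => // v; apply: le_trans (FB v) _.
have : J%:R * B <= 4 * (l * B) by rewrite mulrA ler_wpM2r.
have : 0 <= l * B by rewrite mulr_ge0//; lra.
by rewrite -[72 * _ * B]mulrA; lra.
Qed.

End Potentials.

(** * Branching programs as walks, and their Fourier coefficients *)

Section Programs.

Context (R : realType) (n w : nat) (B : ordered_bp n w) (S : {set layer B n}).

Definition state := {i : 'I_n.+1 & layer B i}.

Definition time (u : state) : nat := tag u.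

Definition mk_state i (le_in : (i <= n)%N) (v : layer B i) : state :=
  Tagged (fun j : 'I_n.+1 => layer B j) (i := Ordinal (le_in : (i < n.+1)%N)) v.

(** Comparing with [true] by [=P] yields the proof of [time u < n] that [step] takes. *)
Definition child (u : state) (b : bool) : state :=
  if (time u < n)%N =P true is ReflectT lt_un
  then mk_state lt_un (step lt_un (tagged u) b) else u.

Lemma time_child u b : (time u < n)%N -> time (child u b) = (time u).+1.
Proof. by rewrite /child; case: eqP. Qed.

Lemma child_mk_state i (le_in : (i <= n)%N) (lt_in : (i < n)%N) (v : layer B i) b :
  child (mk_state le_in v) b = mk_state lt_in (step lt_in v b).
Proof.
rewrite /child; case: eqP => [lt_in'|]; last by rewrite /time /= lt_in.
by rewrite /= (bool_irrelevance lt_in' lt_in).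
Qed.

Definition bit (x : cube n) (i : nat) : bool := if insub i is Some j then x j else false.

Lemma bit_ord x (i : 'I_n) : bit x i = x i.
Proof. by rewrite /bit valK. Qed.

Fixpoint traj (x : cube n) (i : nat) : state :=
  if i is j.+1 then child (traj x j) (bit x j) else mk_state (leq0n n) (start B).

Lemma traj_run x i (le_in : (i <= n)%N) : traj x i = mk_state le_in (run B x le_in).
Proof.
elim: i le_in => [|i IH] le_in /=; first by rewrite (bool_irrelevance le_in (leq0n n)).
by rewrite (IH (ltnW le_in)) child_mk_state (bit_ord x (Ordinal le_in)).
Qed.

Lemma time_traj x i : (i <= n)%N -> time (traj x i) = i.
Proof. by move=> le_in; rewrite (traj_run x le_in). Qed.

Lemma width_le_states : width_le time n [set: state] w.
Proof.
move=> t lt_tn; apply: leq_trans (width_layer B (ltnW lt_tn)).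
rewrite -cardsT; apply: leq_trans (leq_imset_card (mk_state (ltnW lt_tn)) _).
apply: subset_leq_card; apply/subsetP=> -[[i lt_in] v]; rewrite inE => /andP[_ /eqP it].
have {}it : i = t by []; subst t.
apply/imsetP; exists v => //.
by rewrite /mk_state (bool_irrelevance (ltnW lt_tn : (i < n.+1)%N) lt_in).
Qed.

Definition flip (i : 'I_n) (x : cube n) : cube n := [ffun j => x j (+) (j == i)].

Lemma flipK i : involutive (flip i).
Proof. by move=> x; apply/ffunP => j; rewrite !ffunE addbK. Qed.

Lemma flip_neq i j x : j != i -> flip i x j = x j.
Proof. by rewrite ffunE => /negPf ->; rewrite addbF. Qed.

Lemma traj_flip (i : 'I_n) x j : (j <= i)%N -> traj (flip i x) j = traj x j.
Proof.
elim: j => //= j IH lt_ji; rewrite (IH (ltnW lt_ji)); congr child.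
have lt_jn := ltn_trans lt_ji (ltn_ord i).
by rewrite !(bit_ord _ (Ordinal lt_jn)) flip_neq// -val_eqE/= ltn_eqF.
Qed.

(** Pair each [x] with [flip i x]: the two carry both values of bit [i]. *)
Lemma sum_flip (i : 'I_n) (G : cube n -> bool -> R) :
  (forall x b, G (flip i x) b = G x b) ->
  \sum_x G x (x i) = \sum_x (G x false + G x true) / 2.
Proof.
move=> Gi; rewrite -mulr_suml; apply: (canRL (mulfK _)); first by rewrite pnatr_eq0.
rewrite mulr_natr mulr2n {2}(reindex_inj (inv_inj (flipK i))) -big_split /=.
apply: eq_bigr => x _; rewrite Gi ffunE eqxx addbT.
by case: (x i) => //=; rewrite addrC.
Qed.

Fixpoint accept_rec (m : nat) (u : state) : R :=
  if m is m'.+1 then avg child (accept_rec m') u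
  else (u \in [set mk_state (leqnn n) v | v in S])%:R.

Definition accept_prob (u : state) : R := accept_rec (n - time u) u.

Lemma accept_prob_bounded : bounded 1 accept_prob.
Proof.
rewrite /accept_prob => u; move: (n - time u)%N => m.
elim: m u => [|m IH] u /=.
  by rewrite ler0n lern1; case: (_ \in _).
exact: avg_bounded.
Qed.

Lemma avg_accept_prob u : (time u < n)%N -> avg child accept_prob u = accept_prob u.
Proof.
by move=> lt_un; rewrite {2}/accept_prob -(subnSK lt_un)/= /avg /accept_prob !time_child.
Qed.

Lemma accept_prob_final x : accept_prob (traj x n) = (final B x \in S)%:R.
Proof.
rewrite /accept_prob time_traj// subnn /= (traj_run x (leqnn n)) mem_imset//.
by move=> u v /eqP; rewrite eq_Tagged => /eqP.
Qed.

(** Neither [traj x i] nor [g x] depends on coordinate [i], so that bit can be averaged out. *)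
Lemma sum_traj_step (G : state -> R) (g : cube n -> R) (i : 'I_n) :
  (forall x, g (flip i x) = g x) ->
  \sum_x G (traj x i.+1) * g x = \sum_x avg child G (traj x i) * g x.
Proof.
move=> gi; under eq_bigr => x _ do rewrite /= bit_ord.
rewrite (sum_flip (G := fun x b => G (child (traj x i) b) * g x)).
  by apply: eq_bigr => x _; rewrite -mulrDl mulrAC.
by move=> x b; rewrite traj_flip// gi.
Qed.
(** Martingale property: [g] sees only coordinate [i], so the bits read after it average out. *)
Lemma sum_accept_traj (i : 'I_n) (g : cube n -> R) j :
  (forall k x, k != i -> g (flip k x) = g x) -> (i < j <= n)%N ->
  \sum_x accept_prob (traj x j) * g x = \sum_x accept_prob (traj x i.+1) * g x.
Proof.
move=> gk /andP[]; elim: j => // j IH; rewrite ltnS leq_eqVlt => /orP[/eqP<-//|ij] jn.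
rewrite -(IH ij (ltnW jn)) (@sum_traj_step _ _ (Ordinal jn)).
  by apply: eq_bigr => x _; rewrite avg_accept_prob// time_traj// ltnW.
by move=> x; apply: gk; rewrite -val_eqE/= gtn_eqF.
Qed.

(** Averaging bit [i] against its sign leaves half the difference of [accept_prob] at the two
    successors, whose absolute value is [osc]. *)
Lemma norm_fourier_le (i : 'I_n) :
  `|fourier (fun x => (final B x \in S)%:R : R) [set i]|
    <= (\sum_x osc child accept_prob (traj x i)) / #|{: cube n}|%:R.
Proof.
rewrite /fourier /unif_expectation normrM [X in _ * X]ger0_norm ?invr_ge0//.
rewrite ler_wpM2r ?invr_ge0//.
pose g (x : cube n) : R := (-1) ^+ x i.
under eq_bigr => x _ do rewrite big_set1 -accept_prob_final -/(g x).
rewrite (sum_accept_traj (i := i)) ?ltn_ord ?leqnn//; last first.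
  by move=> k x ki; rewrite /g flip_neq// eq_sym.
under eq_bigr => x _ do rewrite /= bit_ord /g.
rewrite (sum_flip (G := fun x b => accept_prob (child (traj x i) b) * (-1) ^+ b)).
  apply: le_trans (ler_norm_sum _ _ _) _; apply: ler_sum => x _.
  by rewrite /osc expr0 expr1 mulr1 mulrN1 normrM (@ger0_norm _ 2^-1) ?invr_ge0.
by move=> x b; rewrite traj_flip.
Qed.

Lemma L1_le_potential (F : state -> R) (b : R) :
  dominates time child n [set: state] F (osc child accept_prob) ->
  (forall u, F u <= b) ->
  L1 (fun x => (final B x \in S)%:R : R) <= b.
Proof.
move=> [F0 FP] Fb; pose N : R := #|{: cube n}|%:R.
have N0 : 0 < N by rewrite ltr0n; apply/card_gt0P; exists [ffun=> false].
(* Summed over all inputs, the accumulated cost plus the current potential does not increase with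
   [m]. *)
have key m : (m <= n)%N ->
    \sum_(i < m) \sum_x osc child accept_prob (traj x i) + \sum_x F (traj x m)
    <= N * b.
  elim: m => [|m IH] lt_mn.
    rewrite big_ord0 add0r mulr_natl -sumr_const.
    by apply: ler_sum => x _; exact: Fb.
  apply: le_trans (IH (ltnW lt_mn)); rewrite big_ord_recr/= -addrA lerD2l.
  have stepF : \sum_x F (traj x m.+1) = \sum_x avg child F (traj x m).
    have := sum_traj_step F (g := fun=> 1) (i := Ordinal lt_mn) (fun=> erefl).
    by rewrite -!mulr_suml !mulr1.
  rewrite stepF -big_split; apply: ler_sum => x _.
  by apply: FP; rewrite ?inE// time_traj// ltnW.
apply: (@le_trans _ _ ((\sum_(i < n) \sum_x osc child accept_prob (traj x i)) / N)).
  by rewrite mulr_suml; apply: ler_sum => i _; exact: norm_fourier_le.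
rewrite ler_pdivrMr// mulrC; apply: le_trans (key n (leqnn n)).
by rewrite lerDl sumr_ge0.
Qed.

End Programs.

(** * Permuted coordinates, the number of scales, and the conclusion *)

Lemma L1_permute_coords (R : realType) n (p : {perm 'I_n}) (f : cube n -> R) :
  L1 (fun x => f (permute_coords p x)) = L1 f.
Proof.
have coordsK : cancel (@permute_coords n p) (permute_coords p^-1%g).
  by move=> x; apply/ffunP=> i; rewrite !ffunE permKV.
have coordsVK : cancel (permute_coords p^-1%g) (@permute_coords n p).
  by move=> x; apply/ffunP=> i; rewrite !ffunE permK.
rewrite /L1 [RHS](reindex_inj (@perm_inj _ p^-1%g)); apply: eq_bigr => i _.
rewrite /fourier /unif_expectation; congr `|_ / _|.
rewrite [LHS](reindex_inj (can_inj coordsVK)); apply: eq_bigr => x _.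
by rewrite coordsVK !big_set1 ffunE.
Qed.

Lemma scale_count (R : realType) n : (2 <= n)%N ->
  exists J : nat, (n%:R : R) * (2 / 3) ^+ J <= 1 /\ J%:R <= 4 * log2 (n%:R : R).
Proof.
(* With [n < 2 ^ t.+1], the product is at most [(8 / 9) ^+ t.+1]; and [2 * t.+1 <= 4 * t] because
   [1 <= t]. *)
move=> n2; pose t := trunc_log 2 n; exists (2 * t.+1)%N.
have n0 : (0 < n)%N by exact: ltnW.
have tn : (2 ^ t <= n)%N by exact: trunc_logP.
have nt : (n < 2 ^ t.+1)%N by exact: trunc_log_ltn.
have t1 : (1 <= t)%N by rewrite trunc_log_gt0.
have l2 : 0 < ln 2 :> R by rewrite ln_gt0// ltr1n.
split.
  have : (n%:R : R) * (2 / 3) ^+ (2 * t.+1) <= (2 ^ t.+1)%:R * (2 / 3) ^+ (2 * t.+1).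
    by rewrite ler_wpM2r ?exprn_ge0 ?divr_ge0// ler_nat ltnW.
  move=> /le_trans; apply; rewrite exprM natrX -exprMn exprn_ile1//; lra.
have tl : t%:R <= log2 (n%:R : R).
  rewrite /log2 ler_pdivlMr// mulr_natl -lnXn// ler_ln ?posrE ?exprn_gt0 ?ltr0n//.
  by rewrite -natrX ler_nat.
have : (1 : R) <= t%:R by rewrite ler1n.
rewrite natrM -natr1; lra.
Qed.

Theorem theorem1p5 (R : realType) :
  exists C : R, 0 < C /\
    forall n w : nat, (2 <= n)%N -> (2 <= w)%N ->
    forall f : cube n -> bool,
      computed_by_read_once_oblivious_bp w f ->
      L1 (fun x => (f x)%:R : R) <= C * (C * log2 n%:R) ^+ (w - 2).
Proof.
exists 1728; split; first exact: ltr0n.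
move=> n w n2 w2 f [f' [p [[B [S f'E]] fE]]].
have [J [nJ Jl]] := scale_count R n2.
have l1 : 1 <= log2 (n%:R : R).
  have l2 : 0 < ln 2 :> R by rewrite ln_gt0// ltr1n.
  by rewrite /log2 ler_pdivlMr// mul1r ler_ln ?posrE ?ltr0n ?ler_nat// ltnW.
have -> : L1 (fun x => (f x)%:R : R) = L1 (fun x => (final B x \in S)%:R : R).
  rewrite -[RHS](L1_permute_coords p); apply: eq_bigr => i _; congr `|_ / _|.
  by apply: eq_bigr => x _; rewrite fE f'E.
have wB : width_le (@time n w B) n [set: state B] (w - 2).+2.
  by rewrite -addn2 subnK//; exact: width_le_states.
have [F FP Fb] := osc_potential (@time_child n w B) (ltnW n2) nJ l1 Jl
  (accept_prob_bounded R S) (@avg_accept_prob R n w B S) wB.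
exact: L1_le_potential FP Fb.
Qed.
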